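(* Let $N\in\mathbb{N}$ and let $\mathscr{E}^{\rm a}(y)=\sum_{\xi\in\Omega_N}V(D_{\mathcal{R}}y(\xi))$ for $N$-periodic atomistic deformations $y$ of a $2$-lattice, with finite interaction range $\mathcal{R}$ and site potential $V:(\mathbb{R}^d)^{\mathcal{R}}\to\mathbb{R}$. Let $R(\xi,\alpha):=(-\xi,\neg\alpha)$ on $\mathbb{Z}^d\times\{0,1\}$, and suppose that $$\mathscr{E}^{\rm a}(y)=\mathscr{E}^{\rm a}(y\circ R)=\mathscr{E}^{\rm a}(-y\circ R)\qquad\text{for all $N$-periodic deformations } y.$$ Then, for all $N$-periodic deformations $y$, $$\mathscr{E}^{\rm a}(y)=\sum_{\xi\in\Omega_N}\bar V\big(D_{\bar{\mathcal{R}}}y(\xi)\big),$$ where $\bar{\mathcal{R}}:=\mathcal{R}\cup\neg\mathcal{R}$ and $\bar V:(\mathbb{R}^d)^{\bar{\mathcal{R}}}\to\mathbb{R}$, $$\bar V\big(\{g_{\boldsymbol{\rho}}\}_{\boldsymbol{\rho}\in\bar{\mathcal{R}}}\big):=\tfrac12V\big(\{g_{\boldsymbol{\rho}}\}_{\boldsymbol{\rho}\in\mathcal{R}}\big)+\tfrac12V\big(\{-g_{\neg\boldsymbol{\rho}}\}_{\boldsymbol{\rho}\in\mathcal{R}}\big),$$ is point symmetric with respect to $\neg$, i.e. $\neg\bar{\mathcal{R}}=\bar{\mathcal{R}}$ and $\bar V(\{g_{\boldsymbol{\rho}}\}_{\boldsymbol{\rho}\in\bar{\mathcal{R}}})=\bar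 V(\{-g_{\neg\boldsymbol{\rho}}\}_{\boldsymbol{\rho}\in\bar{\mathcal{R}}})$ for all $\{g_{\boldsymbol{\rho}}\}\in(\mathbb{R}^d)^{\bar{\mathcal{R}}}$.
   Context: Here $d\in\{1,2,3\}$. Interaction range: $\mathcal{R}$ is a finite subset of $\mathbb{Z}^d\times\{0,1\}\times\{0,1\}\setminus\{(0;0,0),(0;1,1)\}$; its elements are written $\boldsymbol{\rho}=(\rho;\alpha,\beta)$. The site potential $V$ is assumed to be of class $C^3$ on $(\mathbb{R}^d)^{\mathcal{R}}$. Negation: $\neg0:=1$, $\neg1:=0$, $\neg(\rho;\alpha,\beta):=(-\rho;\neg\alpha,\neg\beta)$, and $\neg\mathcal{R}:=\{\neg\boldsymbol{\rho}:\boldsymbol{\rho}\in\mathcal{R}\}$. An atomistic deformation is a map $y:\mathbb{Z}^d\times\{0,1\}\to\mathbb{R}^d$, with $y_\alpha(\xi):=y(\xi,\alpha)$. It is $N$-periodic if $y_\alpha(\xi)=B\xi+u_\alpha(\xi)$ for some $B\in \mathrm{GL}(d)$ and some $u:\mathbb{Z}^d\times\{0,1\}\to\mathbb{R}^d$ with $u_\alpha(\xi+N\eta)=u_\alpha(\xi)$ for all $\xi,\eta\in\mathbb{Z}^d$. For any $\boldsymbol{\rho}=(\rho;\alpha,\beta)\in\mathbb{Z}^d\times\{0,1\}^2$, $D_{\boldsymbol{\rho}}y(\xi):=y_\beta(\xi+\rho)-y_\alpha(\xi)$, and for a finite set $S$ of such triples $D_Sy(\xi):=(D_{\boldsymbol{\rho}}y(\xi))_{\boldsymbol{\rho}\in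 S}$. $\Omega_N:=\{0,1,\dots,N-1\}^d$. *)

(* Defs.v *)
From HB Require Import structures.
From mathcomp Require Import all_boot all_order all_algebra finmap.
From mathcomp Require Import all_classical all_reals all_analysis.

Set Implicit Arguments.
Unset Strict Implicit.
Unset Printing Implicit Defensive.
Import Order.TTheory GRing.Theory Num.Theory.
Import numFieldNormedType.Exports.
Local Open Scope ring_scope.

(* The species index set {0,1} is bool, with 0 = false, 1 = true; negation of
   species is negb. *)
Definition site (d : nat) : Type := ('cV[int]_d * bool)%type.

(* (rho, a, b) stands for (rho; a, b). *)
Definition bond (d : nat) := ('cV[int]_d * bool * bool)%type.

Definition neg_bond d (r : bond d) : bond d :=
  let: (rho, a, b) := r in (- rho, ~~ a, ~~ b).

Definition neg_range d (S : {fset bond d}) : {fset bond d} :=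
  [fset neg_bond r | r in S]%fset.

Definition interaction_range d (S : {fset bond d}) : Prop :=
  (0, false, false) \notin S /\ (0, true, true) \notin S.

Definition sym_range d (S : {fset bond d}) : {fset bond d} :=
  (S `|` neg_range S)%fset.

Section Kinematics.
Context {R : realType} {d : nat}.

Definition config (S : {fset bond d}) : Type := {ffun S -> 'cV[R]_d}.

Definition deformation : Type := site d -> 'cV[R]_d.

Definition periodic_deformation (N : nat) (y : deformation) : Prop :=
  exists (B : 'M[R]_d) (u : site d -> 'cV[R]_d),
    [/\ B \in unitmx,
        forall (xi eta : 'cV[int]_d) (a : bool),
          u (xi + eta *+ N, a) = u (xi, a) &
        forall (xi : 'cV[int]_d) (a : bool),
          y (xi, a) = B *m map_mx intr xi + u (xi, a)].

Definition reflection (p : site d) : site d := (- p.1, ~~ p.2).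

Definition bond_diff (r : bond d) (y : deformation) (xi : 'cV[int]_d) : 'cV[R]_d :=
  let: (rho, a, b) := r in y (xi + rho, b) - y (xi, a).

Definition stencil_diff (S : {fset bond d}) (y : deformation)
    (xi : 'cV[int]_d) : config S :=
  [ffun r : S => bond_diff (val r) y xi].

(* 'cV['I_N]_d enumerates the cell {0, ..., N-1}^d; cell_point embeds it in Z^d. *)
Definition cell_point N (x : 'cV['I_N]_d) : 'cV[int]_d :=
  map_mx (fun i : 'I_N => (i : nat)%:Z) x.

Definition energy (N : nat) (S : {fset bond d}) (V : config S -> R)
    (y : deformation) : R :=
  \sum_(x : 'cV['I_N]_d) V (stencil_diff S y (cell_point x)).

End Kinematics.

Arguments config R {d} S.
Arguments deformation R d : clear implicits.

Lemma neg_bond_sym_range d (S : {fset bond d}) (r : S) :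
  neg_bond (val r) \in sym_range S.
Proof. by rewrite in_fsetU; apply/orP; right; apply: in_imfset; exact: valP. Qed.

Lemma neg_bond_closed d (S : {fset bond d}) (hS : neg_range S = S) (r : S) :
  neg_bond (val r) \in S.
Proof.
have : neg_bond (val r) \in neg_range S by apply: in_imfset; exact: valP.
by rewrite hS.
Qed.

Section Symmetry.
Context {R : realType} {d : nat}.

Definition restrict_config (S : {fset bond d}) (g : config R (sym_range S)) :
    config R S :=
  [ffun r : S => g (fincl (fsubsetUl S (neg_range S)) r)].

Definition reflect_config (S : {fset bond d}) (g : config R (sym_range S)) :
    config R S :=
  [ffun r : S => - g [` neg_bond_sym_range r]%fset].

Definition sym_potential (S : {fset bond d}) (V : config R S -> R)
    (g : config R (sym_range S)) : R :=
  2^-1 * V (restrict_config g) + 2^-1 * V (reflect_config g).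

(* The equation on W only makes sense once neg_range S = S, hence the
   dependent conjunction. *)
Definition point_symmetric (S : {fset bond d}) (W : config R S -> R) : Prop :=
  exists hS : neg_range S = S, forall g : config R S,
    W g = W [ffun r : S => - g [` neg_bond_closed hS r]%fset].

(* On a finite-dimensional E, this is k-fold continuous Frechet
   differentiability: continuity of the k-th derivative is tested on all
   directions. *)
Fixpoint class_C (k : nat) (E : normedModType R) (f : E -> R^o) : Prop :=
  match k with
  | 0 => continuous f
  | k'.+1 => (forall x, differentiable f x) /\ forall v, class_C k' ('D_v f)
  end.

(* The library has no norm on {ffun S -> 'cV[R]_d}; it is identified linearly
   with the normed space of matrices whose rows are indexed by S. *)
Definition config_of_mx (S : {fset bond d}) (M : 'M[R]_(#|{: S}|, d)) :
    config R S :=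
  [ffun r : S => (row (enum_rank r) M)^T].

Definition potential_C (k : nat) (S : {fset bond d}) (V : config R S -> R) : Prop :=
  class_C k (fun M : 'M[R]_(#|{: S}|, d) => V (config_of_mx M)).

End Symmetry.

(* Main.v *)
Require Import Defs.
From mathcomp Require Import all_boot all_order all_algebra finmap.
From mathcomp Require Import all_classical all_reals all_analysis.
Import GRing.Theory Num.Theory.
Local Open Scope ring_scope.

(** Write [y'] for the map [- (y \o reflection)].  The finite difference of
    [y'] along a bond [r] at [xi] is minus the difference of [y] along
    [neg_bond r] at [- xi] ([bond_diff_opp_reflection]), so the local
    configuration of [y'] at [xi] is the reflected configuration of [y] at
    [- xi] ([reflect_stencil_diff]).  Differences of a periodic deformation are
    [N]-periodic, as the affine part only contributes a constant; hence
    summing over the reflected cell is the same as summing over the cell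
    ([sum_cell_opp]), and the energy of [y'] is the sum over the cell of [V] at
    the reflected configurations of [y] ([energy_opp_reflection]).  By the
    symmetry hypothesis this equals the energy of [y], and the energy of the
    symmetrized potential is the mean of these two equal numbers.

    Point symmetry holds because [neg_bond] is an involution: negating a
    configuration along it exchanges the two terms that [sym_potential]
    averages. *)

Lemma neg_bondK d : involutive (@neg_bond d).
Proof. by case=> [[rho a] b] /=; rewrite opprK !negbK. Qed.

Lemma neg_range_sym_range d (S : {fset bond d}) :
  neg_range (sym_range S) = sym_range S.
Proof.
rewrite /neg_range imfsetU -/(neg_range S) fsetUC; congr (_ `|` _)%fset.
by apply/fsetP=> r; apply/imfsetP/idP => /= [[_ /imfsetP[s sS ->] ->]|rS];
  [rewrite neg_bondK | exists (neg_bond r); rewrite ?neg_bondK // in_imfset].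
Qed.

Section Reflection.
Context {R : realType} {d : nat}.
Implicit Types (S : {fset bond d}) (y : deformation R d).

Lemma bond_diff_opp_reflection (r : bond d) y (xi : 'cV[int]_d) :
  bond_diff r (\- (y \o reflection)) xi = - bond_diff (neg_bond r) y (- xi).
Proof.
by case: r => [[rho a] b]; rewrite /= /reflection /= opprD [RHS]opprD.
Qed.

Lemma restrict_stencil_diff S y (xi : 'cV[int]_d) :
  restrict_config (stencil_diff (sym_range S) y xi) = stencil_diff S y xi.
Proof. by apply/ffunP=> r; rewrite !ffunE. Qed.

Lemma reflect_stencil_diff S y (xi : 'cV[int]_d) :
  reflect_config (stencil_diff (sym_range S) y (- xi)) =
  stencil_diff S (\- (y \o reflection)) xi.
Proof. by apply/ffunP=> r; rewrite !ffunE bond_diff_opp_reflection. Qed.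

(** The reflection of a reflected configuration is a plain restriction, so the
    two halves of [sym_potential V] are swapped. *)
Lemma point_symmetric_sym_potential S (V : config R S -> R) :
  point_symmetric (sym_potential V).
Proof.
exists (neg_range_sym_range d S) => g.
rewrite /sym_potential addrC; congr (_ * V _ + _ * V _).
  apply/ffunP=> r; rewrite !ffunE; congr (- g _); exact: val_inj.
apply/ffunP=> r; rewrite !ffunE opprK; congr (g _); apply: val_inj => /=.
by rewrite neg_bondK.
Qed.

Lemma stencil_diff_periodic N S y : periodic_deformation N y ->
  forall xi eta : 'cV[int]_d,
    stencil_diff S y (xi + eta *+ N) = stencil_diff S y xi.
Proof.
case=> B [u [_ uN yE]] xi eta; apply/ffunP=> -[[[rho a] b] rS]; rewrite !ffunE /=.
have yN z c : y (z + eta *+ N, c) = y (z, c) + B *m map_mx intr (eta *+ N).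
  by rewrite !yE uN map_mxD mulmxDr addrAC.
by rewrite addrAC !yN opprD addrACA subrr addr0.
Qed.

End Reflection.

Lemma ord_gt0 {N} (i : 'I_N) : (0 < N)%N.
Proof. exact: leq_ltn_trans (ltn_ord i). Qed.

(** Negation modulo [N].  The bound [0 < N] comes from [i] itself, so that the
    case [N = 0], where ['I_N] is not a ring, needs no separate treatment. *)
Definition neg_ord N (i : 'I_N) : 'I_N :=
  Ordinal (ltn_pmod (N - i) (ord_gt0 i)).

Lemma neg_ordE N (i : 'I_N) : neg_ord N i = ((i != 0 :> nat) * N - i)%N :> nat.
Proof.
rewrite /=; have [->|i0] := eqVneq (i : nat) 0%N; first by rewrite subn0 modnn.
by rewrite mul1n modn_small // ltn_subrL lt0n i0 (ord_gt0 i).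
Qed.

Lemma neg_ordK N : involutive (neg_ord N).
Proof.
move=> i; apply: ord_inj; rewrite [LHS]/= (neg_ordE _ i : ((N - i) %% N)%N = _).
have [->|i0] := eqVneq (i : nat) 0%N; first by rewrite mul0n sub0n subn0 modnn.
by rewrite mul1n subKn ?modn_small // ltnW.
Qed.

(** Off the coordinate hyperplanes [- x] lies in the opposite cell, one period
    away in every coordinate; a vanishing coordinate needs no shift. *)
Lemma cell_point_neg d N (x : 'cV['I_N]_d) :
  cell_point (map_mx (neg_ord N) x) =
  - cell_point x + (\col_i ((x i 0 != 0 :> nat) : nat)%:Z) *+ N.
Proof.
apply/colP=> i; rewrite !mxE mulmxnE !mxE neg_ordE pmulrn mulrzz.
have [->|i0] := eqVneq (x i 0 : nat) 0%N; first by rewrite mul0n.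
by rewrite mul1n mul1r addrC subzn // ltnW.
Qed.

Lemma sum_cell_opp (R : nmodType) d N (f : 'cV[int]_d -> R) :
    (forall xi eta, f (xi + eta *+ N) = f xi) ->
  \sum_(x : 'cV['I_N]_d) f (- cell_point x) =
  \sum_(x : 'cV['I_N]_d) f (cell_point x).
Proof.
move=> fN; have negK : involutive (map_mx (neg_ord N) : 'cV_d -> 'cV_d).
  by move=> x; apply/matrixP=> i j; rewrite !mxE neg_ordK.
rewrite [RHS](reindex_inj (inv_inj negK)).
by apply: eq_bigr => x _; rewrite cell_point_neg fN.
Qed.

Lemma energy_opp_reflection (R : realType) d N (S : {fset bond d})
    (V : config R S -> R) (y : deformation R d) : periodic_deformation N y ->
  energy N V (\- (y \o reflection)) =
  energy N (fun g => V (reflect_config g)) y.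
Proof.
move=> yN; rewrite /energy.
rewrite -(sum_cell_opp _ _ _
  (fun xi => V (reflect_config (stencil_diff (sym_range S) y xi)))).
  by apply: eq_bigr => x _; rewrite reflect_stencil_diff.
by move=> xi eta; rewrite (stencil_diff_periodic N).
Qed.

Theorem proposition4p2 (R : realType) (d : nat) (hd : (1 <= d <= 3)%N) (N : nat)
    (S : {fset bond d}) (hS : interaction_range S)
    (V : config R S -> R) (hV : potential_C 3 V)
    (hsym : forall y : deformation R d, periodic_deformation N y ->
      energy N V y = energy N V (y \o reflection) /\
      energy N V (y \o reflection) = energy N V (\- (y \o reflection))) :
  (forall y : deformation R d, periodic_deformation N y ->
     energy N V y = energy N (sym_potential V) y) /\
  point_symmetric (sym_potential V).
Proof.
split=> [y yN|]; last exact: point_symmetric_sym_potential.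
have [Ey Ey'] := hsym y yN.
have -> : energy N (sym_potential V) y =
    2^-1 * energy N V y + 2^-1 * energy N V (\- (y \o reflection)).
  rewrite energy_opp_reflection // /energy !mulr_sumr -big_split /=.
  by apply: eq_bigr => x _; rewrite /sym_potential restrict_stencil_diff.
by rewrite -Ey' -Ey -mulrDl -[X in X + X]mul1r -splitr mul1r.
Qed.
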